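(* Let $(V,g)$ be an inner product vector space over $k$, with $k=\mathbb{R}$ or $k=\mathbb{C}$ (possibly infinite-dimensional), and let $\varphi\in\operatorname{End}_k(V)$ be a finite potent endomorphism, admissible for the Moore-Penrose inverse, with $i(\varphi)\leq 1$. Then the core inverse of $\varphi$ is $$\varphi^{(\#)}=\varphi^{\#}\circ\varphi\circ\varphi^{\dagger}.$$
   Context: An endomorphism $\varphi$ of $V$ is finite potent if $\varphi^n(V)$ is finite-dimensional for some $n$. Equivalently, there is a (unique) $\varphi$-invariant decomposition $V=W_\varphi\oplus U_\varphi$ (AST-decomposition) with $\varphi|_{U_\varphi}$ nilpotent, $W_\varphi$ finite-dimensional and $\varphi|_{W_\varphi}$ an automorphism of $W_\varphi$. The index $i(\varphi)$ is the nilpotency order of $\varphi|_{U_\varphi}$; $i(\varphi)\le 1$ iff $W_\varphi=\operatorname{Im}(\varphi)$ iff $U_\varphi=\operatorname{Ker}(\varphi)$. $\varphi$ is admissible for the Moore-Penrose inverse if $V=\operatorname{Ker}(\varphi)\oplus[\operatorname{Ker}(\varphi)]^{\perp}$ and $V=\operatorname{Im}(\varphi)\oplus[\operatorname{Im}(\varphi)]^{\perp}$. In that case the Moore-Penrose inverse $\varphi^\dagger$ is the unique linear map with $\varphi\varphi^\dagger\varphi=\varphi$, $\varphi^\dagger\varphi\varphi^\dagger=\varphi^\dagger$ and both $\varphi^\dagger\varphi$ and $\varphi\varphi^\dagger$ self-adjoint with respect to $g$; explicitly $\varphi^\dagger=(\varphi|_{[\operatorname{Ker}(\varphi)]^\perp})^{-1}$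 on $\operatorname{Im}(\varphi)$ and $\varphi^\dagger=0$ on $[\operatorname{Im}(\varphi)]^\perp$. The group inverse $\varphi^{\#}$ of a finite potent $\varphi$ with $i(\varphi)\le1$ is the unique linear map with $\varphi\varphi^{\#}\varphi=\varphi$, $\varphi^{\#}\varphi\varphi^{\#}=\varphi^{\#}$, $\varphi\varphi^{\#}=\varphi^{\#}\varphi$. The core inverse $\varphi^{(\#)}$ is the linear map satisfying $\varphi\circ\varphi^{(\#)}=P_{\operatorname{Im}(\varphi)}$ and $\operatorname{Im}(\varphi^{(\#)})\subseteq\operatorname{Im}(\varphi)$, where $P_{\operatorname{Im}(\varphi)}$ is the orthogonal projection onto $\operatorname{Im}(\varphi)$ induced by $V=\operatorname{Im}(\varphi)\oplus[\operatorname{Im}(\varphi)]^{\perp}$ (it exists and is unique when $i(\varphi)\le 1$). *)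

(* Defs.v *)
From HB Require Import structures.
From mathcomp Require Import all_boot all_order all_algebra.
From mathcomp Require Import complex.
From mathcomp Require Import boolp classical_sets functions reals.

Set Implicit Arguments.
Unset Strict Implicit.
Unset Printing Implicit Defensive.

Import Order.TTheory GRing.Theory Num.Theory.
Local Open Scope classical_set_scope.
Local Open Scope ring_scope.

Variant ground_field := RealField | ComplexField.

Definition scalars (R : realType) (k : ground_field) : numFieldType :=
  match k with RealField => R | ComplexField => R[i] end.

Definition scalar_conj (R : realType) (k : ground_field) :
    scalars R k -> scalars R k :=
  match k with RealField => idfun | ComplexField => @Num.conj R[i] end.

Section LinearNotions.
Context {K : numFieldType} {V : lmodType K}.
Implicit Types (A B W U : set V) (phi psi : {linear V -> V}).

Definition is_subspace A : Prop := submod_closed (mem A).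

Definition direct_sum A B : Prop :=
  (forall v, exists a b, [/\ A a, B b & v = a + b]) /\ A `&` B = [set 0].

Definition finite_dimensional A : Prop :=
  exists s : seq V, forall v, A v ->
    exists c : 'I_(size s) -> K, v = \sum_i c i *: s`_i.

Definition lin_image phi : set V := range phi.

Definition lin_kernel phi : set V := phi @^-1` [set 0].

Definition finite_potent phi : Prop :=
  exists n, finite_dimensional (range (iter n phi)).

Definition pow_vanishes_on phi U (n : nat) : Prop :=
  forall u, U u -> iter n phi u = 0.

Record AST_decomposition phi W U : Prop := {
  AST_subspaceW : is_subspace W;
  AST_subspaceU : is_subspace U;
  AST_direct_sum : direct_sum W U;
  AST_invariantU : phi @` U `<=` U;
  AST_nilpotentU : exists n, pow_vanishes_on phi U n;
  AST_finite_dimW : finite_dimensional W;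
  (* includes the invariance of [W] *)
  AST_automorphismW : set_bij W W phi }.

(* For [U = 0] the nilpotency order is 0, so automorphisms have index 0. *)
Definition has_index phi (n : nat) : Prop :=
  exists W U, [/\ AST_decomposition phi W U, pow_vanishes_on phi U n &
    forall m, pow_vanishes_on phi U m -> (n <= m)%N].

(* Some linear map satisfying [P], with junk value 0 if there is none; applied
   below to characterizations that determine the map uniquely. *)
Definition the_linear_map (P : {linear V -> V} -> Prop) : {linear V -> V} :=
  xget (\0 : {classic {linear V -> V}}) P.

Definition is_group_inverse phi psi : Prop :=
  [/\ phi \o psi \o phi =1 phi, psi \o phi \o psi =1 psi
    & phi \o psi =1 psi \o phi].

Definition group_inverse phi : {linear V -> V} :=
  the_linear_map (is_group_inverse phi).

Context {conj : K -> K} (g : {dot V for conj}).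

Definition orthogonal_complement A : set V :=
  [set v | forall a, A a -> g v a = 0].

Definition MP_admissible phi : Prop :=
  direct_sum (lin_kernel phi) (orthogonal_complement (lin_kernel phi)) /\
  direct_sum (lin_image phi) (orthogonal_complement (lin_image phi)).

Definition self_adjoint (f : V -> V) : Prop :=
  forall u v, g (f u) v = g u (f v).

Definition is_MP_inverse phi psi : Prop :=
  [/\ phi \o psi \o phi =1 phi, psi \o phi \o psi =1 psi,
      self_adjoint (psi \o phi) & self_adjoint (phi \o psi)].

Definition MP_inverse phi : {linear V -> V} :=
  the_linear_map (is_MP_inverse phi).

Definition is_orthogonal_projection A (p : V -> V) : Prop :=
  direct_sum A (orthogonal_complement A) /\
  forall a b, A a -> orthogonal_complement A b -> p (a + b) = a.

Definition is_core_inverse phi psi : Prop :=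
  is_orthogonal_projection (lin_image phi) (phi \o psi) /\
  lin_image psi `<=` lin_image phi.

Definition core_inverse phi : {linear V -> V} :=
  the_linear_map (is_core_inverse phi).

End LinearNotions.

(* Main.v *)
Require Import Defs.
From HB Require Import structures.
From mathcomp Require Import all_boot all_order all_algebra.
From mathcomp Require Import complex.
From mathcomp Require Import boolp classical_sets functions reals.

Set Implicit Arguments.
Unset Strict Implicit.
Unset Printing Implicit Defensive.

Import Order.TTheory GRing.Theory Num.Theory.
Local Open Scope ring_scope.

(** Write psi for the group inverse and mp for the Moore-Penrose inverse of phi.
    Since phi psi phi = phi, the composite phi (psi phi mp) equals phi mp, which
    is a self-adjoint idempotent with image Im phi, hence the orthogonal
    projection onto Im phi; and psi phi mp = phi psi mp takes values in Im phi.
    So psi phi mp is a core inverse. Core inverses are unique because phi is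
    injective on Im phi: if phi (phi x) = 0 then
    phi x = phi psi phi x = psi phi (phi x) = 0. *)

Section LinearRelations.
Context {K : numFieldType} {V : lmodType K}.

(** Two values over the same point differ by a value over 0, so the relation is single-valued and
    any choice function for it is linear. Both generalized inverses are constructed this way. *)
Lemma linear_relation_function (r : V -> V -> Prop) :
  (forall a x y x' y', r x y -> r x' y' -> r (a *: x + x') (a *: y + y')) ->
  (forall x, exists y, r x y) -> (forall y, r 0 y -> y = 0) ->
  exists f : {linear V -> V}, forall x, r x (f x).
Proof.
move=> rlin /choice[f rf] r0.
have r_inj x y y' : r x y -> r x y' -> y = y'.
  move=> rxy rxy'; have := rlin (-1) _ _ _ _ rxy rxy'.
  by rewrite !scaleN1r addNr => /r0/eqP; rewrite addrC subr_eq0 => /eqP->.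
have flin : linear f.
  by move=> a x y; apply: (r_inj _ _ _ (rf _)); exact: rlin.
pose fL := GRing.isLinear.Build K V V _ f flin.
pose F : {linear V -> V} := HB.pack f fL.
by exists F.
Qed.

Lemma the_linear_mapP (P : {linear V -> V} -> Prop) :
  (exists f, P f) -> P (the_linear_map P).
Proof. exact: (@xgetPex {classic {linear V -> V}}). Qed.

End LinearRelations.

Section GroupInverse.
Context {K : numFieldType} {V : lmodType K}.
Implicit Types phi psi : {linear V -> V}.

Lemma subspaceP (A : set V) : is_subspace A ->
  A 0 /\ forall (a : K) u v, A u -> A v -> A (a *: u + v).
Proof.
move=> [A0 Alin]; split; first exact: set_mem A0.
by move=> a u v Au Av; apply: set_mem; apply: Alin; exact: mem_set.
Qed.

Lemma direct_sum_eq0 (A B : set V) v : direct_sum A B -> A v -> B v -> v = 0.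
Proof.
move=> [_ AB0] Av Bv; have : (A `&` B)%classic v by split.
by rewrite AB0.
Qed.

Lemma index_le1_kernel phi i : has_index phi i -> (i <= 1)%N ->
  exists W U, AST_decomposition phi W U /\ forall u, U u -> phi u = 0.
Proof.
move=> [W [U [dec van _]]] i1; exists W, U; split=> // u Uu.
(* For index 0 the vanishing of the zeroth iterate says [u = 0]; for index 1 it is the claim
   itself. *)
case: i i1 van => [|[|//]] _ /(_ _ Uu) /=; last by [].
by move->; rewrite linear0.
Qed.

Lemma group_inverse_exists phi i : has_index phi i -> (i <= 1)%N ->
  exists psi, is_group_inverse phi psi.
Proof.
move=> idx /(index_le1_kernel idx)[W [U [[sW sU dWU _ _ _ bW] kU]]].
have [[W0 Wlin] [U0 Ulin]] := (subspaceP sW, subspaceP sU).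
have phiW w : W w -> W (phi w) by case: bW => + _ _; exact.
have injW w : W w -> phi w = 0 -> w = 0.
  move=> Ww pw; case: bW => _ + _; apply; rewrite ?mem_set//.
  by rewrite pw linear0.
(* That is, [phi w] is the [W]-component of [v]: the resulting map inverts [phi] on [W] and kills
   [U]. *)
pose r v w := W w /\ U (v - phi w).
have [|v|w [Ww]|psi rpsi] := @linear_relation_function _ _ r.
- move=> a x y x' y' [Wy Uxy] [Wy' Uxy']; split; first exact: Wlin.
  by rewrite linearP opprD addrACA -scalerBr; exact: Ulin.
- have [w [u [Ww Uu ->]]] := dWU.1 v.
  case: bW => _ _ /(_ _ Ww)[w' Ww' <-]; exists w'; split=> //.
  by rewrite addrAC subrr add0r.
- rewrite sub0r => Upw; apply: injW => //.
  by rewrite -[LHS]opprK (direct_sum_eq0 dWU _ Upw) ?oppr0// -scaleN1r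
    -[_ *: _]addr0; apply: Wlin => //; exact: phiW.
have psi_uniq v w : r v w -> psi v = w.
  move=> [Ww Uvw]; have [Wp Uvp] := rpsi v.
  have Wd : W (- psi v + w) by rewrite -scaleN1r; exact: Wlin.
  have Ud : U (phi (- psi v + w)).
    have := Ulin (-1) _ _ Uvw Uvp.
    by rewrite scaleN1r opprB addrA subrK -linearB addrC.
  have /(injW _ Wd)/eqP := direct_sum_eq0 dWU (phiW _ Wd) Ud.
  by rewrite addrC subr_eq0 => /eqP.
have phi_psi v : phi (phi (psi v)) = phi v.
  apply/eqP; rewrite eq_sym -subr_eq0 -linearB; apply/eqP/kU.
  exact: (rpsi v).2.
have psi_phi v : psi (phi v) = phi (psi v).
  apply: psi_uniq; split; first by apply: phiW; exact: (rpsi v).1.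
  by rewrite phi_psi subrr.
exists psi; split=> v /=; rewrite ?psi_phi ?phi_psi//.
rewrite -psi_phi; apply: psi_uniq.
by split; [exact: (rpsi v).1 | rewrite subrr; exact: U0].
Qed.

End GroupInverse.

Section DotProduct.
Context {K : numFieldType} {V : lmodType K} {conj : K -> K}.
Variable g : {dot V for conj}.
Implicit Types (phi psi : {linear V -> V}) (A : set V).

Lemma dot_sym0 u v : g u v = 0 -> g v u = 0.
Proof.
have gC x y : g x y = conj (g y x).
  by rewrite (hermitian_subproof (s := g) x y) mul1r.
(* As [conj] is an arbitrary function, [conj 0 = 0] is obtained from the symmetry of [g 0 0]. *)
move=> guv; rewrite gC guv -[in LHS](linear0r g 0) -gC.
exact: linear0r.
Qed.

Lemma dot_eq0 u : g u u = 0 -> u = 0.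
Proof.
move=> guu; apply/eqP/negPn/negP => /(neq0_dnorm_gt0 (s := g)).
by rewrite guu ltxx.
Qed.

Lemma orthogonal_complement_lin A a u v :
  orthogonal_complement g A u -> orthogonal_complement g A v ->
  orthogonal_complement g A (a *: u + v).
Proof.
by move=> Au Av x Ax; rewrite linearPl /= Au // Av // mulr0 addr0.
Qed.

Lemma orthogonal_complementB A u v :
  orthogonal_complement g A u -> orthogonal_complement g A v ->
  orthogonal_complement g A (u - v).
Proof.
move=> Au Av; rewrite addrC -scaleN1r; exact: orthogonal_complement_lin.
Qed.

Lemma orthogonal_complement_eq0 A v :
  A v -> orthogonal_complement g A v -> v = 0.
Proof. by move=> Av /(_ _ Av)/dot_eq0. Qed.

Lemma MP_inverse_exists phi : MP_admissible g phi ->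
  exists psi, is_MP_inverse g phi psi.
Proof.
move=> [[dK _] [dI _]].
pose KO := orthogonal_complement g (lin_kernel phi).
pose IO := orthogonal_complement g (lin_image phi).
(* In other words, [w] is the least-squares solution of [phi w = v] of minimal norm. *)
pose r v w := KO w /\ IO (v - phi w).
have inj w : KO w -> IO (phi w) -> w = 0.
  move=> Kw Ipw; apply: orthogonal_complement_eq0 Kw.
  by apply: orthogonal_complement_eq0 Ipw; exists w.
have [|v|w [Kw]|psi rpsi] := @linear_relation_function _ _ r.
- move=> a x y x' y' [Ky Ixy] [Ky' Ixy']; split.
    exact: orthogonal_complement_lin.
  rewrite linearP opprD addrACA -scalerBr; exact: orthogonal_complement_lin.
- have [_ [b [[x _ <-] Ib ->]]] := dI v.
  have [c [d [/= pc Kd ->]]] := dK x.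
  (* Dropping the kernel component of the preimage [x] leaves its image unchanged. *)
  exists d; split=> //; rewrite linearD pc add0r.
  by rewrite addrAC subrr add0r.
- rewrite sub0r => Ipw; apply: inj => //.
  have := orthogonal_complementB Ipw Ipw; rewrite subrr => I0.
  by have := orthogonal_complementB I0 Ipw; rewrite sub0r opprK.
have phi_psi x : phi (psi (phi x)) = phi x.
  have [_ Ix] := rpsi (phi x).
  apply/eqP; rewrite eq_sym -subr_eq0; apply/eqP.
  apply: orthogonal_complement_eq0 Ix.
  by rewrite -linearB; exists (x - psi (phi x)).
(* Both sides lie in [KO], where [phi] is injective, and have the same image under [phi]. *)
have psi_phi v : psi (phi (psi v)) = psi v.
  have [Kv _] := rpsi v; have [Kpv _] := rpsi (phi (psi v)).
  apply/eqP; rewrite -subr_eq0; apply/eqP; apply: inj.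
    exact: orthogonal_complementB.
  rewrite linearB phi_psi subrr => x _.
  exact: linear0l.
(* Each idempotent P is self-adjoint because Im P and Im (1 - P) are orthogonal. *)
have idem_sa (P : V -> V) :
    (forall u v, g (P u) (v - P v) = 0) -> self_adjoint g P.
  move=> PO u v; transitivity (g (P u) (P v)).
    by apply/eqP; rewrite -subr_eq0 -linearBr; apply/eqP; exact: PO.
  apply/esym/eqP; rewrite -subr_eq0 -linearBl.
  by apply/eqP; apply: dot_sym0; exact: PO.
exists psi; split=> //.
  apply: idem_sa => u v /=; apply: (rpsi (phi u)).1.
  by rewrite /lin_kernel/= linearB phi_psi subrr.
apply: idem_sa => u v /=; apply: dot_sym0; apply: (rpsi v).2.
by exists (psi u).
Qed.

Lemma core_inverse_of phi psi mp : MP_admissible g phi ->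
  is_group_inverse phi psi -> is_MP_inverse g phi mp ->
  is_core_inverse g phi (psi \o phi \o mp : {linear V -> V}).
Proof.
move=> [_ dI] [gi1 _ giC] [mp1 _ _ mpsa].
split; last by move=> _ [v _ <-] /=; exists (psi (mp v)) => //; exact: giC.
split=> // _ b [x _ <-] Ib /=.
have /= -> := gi1 (mp (phi x + b)).
rewrite !linearD; have /= -> := mp1 x.
suff -> : phi (mp b) = 0 by rewrite addr0.
(* Self-adjointness turns the square norm of [phi (mp b)] into the product of [b] with a vector of
   the image, to which [b] is orthogonal. *)
apply: dot_eq0; have /= -> := mpsa b (phi (mp b)).
by apply: Ib; exists (mp (phi (mp b))).
Qed.

Lemma core_inverse_unique phi psi chi chi' : is_group_inverse phi psi ->
  is_core_inverse g phi chi -> is_core_inverse g phi chi' -> chi =1 chi'.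
Proof.
move=> [gi1 _ giC] [[dI pc] ic] [[_ pc'] ic'] v.
have pcc : phi (chi v) = phi (chi' v).
  have [a [b [Ia Ib ->]]] := dI.1 v.
  by have /= -> := pc _ _ Ia Ib; have /= -> := pc' _ _ Ia Ib.
have [x _ xE] : lin_image phi (chi v) by apply: ic; exists v.
have [x' _ xE'] : lin_image phi (chi' v) by apply: ic'; exists v.
(* On the image of [phi], [psi] recovers a vector from its value under [phi]. *)
have imE y : phi y = psi (phi (phi y)).
  by rewrite -[LHS]gi1; exact: giC (phi y).
by rewrite -xE -xE' imE (imE x') xE xE' pcc.
Qed.

End DotProduct.

Theorem theorem4p4 (R : realType) (k : ground_field)
    (V : lmodType (scalars R k)) (g : {dot V for @scalar_conj R k})
    (phi : {linear V -> V}) (i : nat) :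
  finite_potent phi -> MP_admissible g phi -> has_index phi i -> (i <= 1)%N ->
  core_inverse g phi =1 group_inverse phi \o phi \o MP_inverse g phi.
Proof.
move=> _ adm idx i1.
(* Existence ensures that the chosen maps are genuine inverses and not the default 0. *)
have gi := the_linear_mapP (group_inverse_exists idx i1).
have mp := the_linear_mapP (MP_inverse_exists adm).
have core := core_inverse_of adm gi mp.
exact: core_inverse_unique gi (the_linear_mapP (ex_intro _ _ core)) core.
Qed.
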